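(* Let $m$ and $n$ be positive integers with $m > n/2$, and let $(U,A,B_1,\dots,B_{m/2})$ be an admissable ordered collection, where $A$ has order $m$ and $U\subset\mathbb{R}^n$. Let $G(x,y)$ be the Green's function associated with this collection. Then the following statements are equivalent to each other: (i) the solution $u\in\mathcal{D}(A)$ of $$A(x,\partial/\partial x)u(x)=1,\quad x\in U,\qquad B_j(x,\partial/\partial x)u(x)=0,\quad x\in S,\ j=1,\dots,\tfrac{m}{2},$$ is non-negative on $U$; (ii) $\int_U G(x,y)\,dy\geq 0$ for all $x\in U$; (iii) for every non-negative $f\in L^2(U)$, the mean value over $U$ of the solution $u\in\mathcal{D}(A)$ of $$A(x,\partial/\partial x)u(x)=f(x),\quad x\in U,\qquad B_j(x,\partial/\partial x)u(x)=0,\quad x\in S,\ j=1,\dots,\tfrac{m}{2},$$ is non-negative.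
   Context: All functions are real-valued, and $L^2(U)$, $H^m(U)$ denote the usual (real) Lebesgue and Sobolev spaces. Let $n$ be a positive integer and let $U$ be a bounded domain of $\mathbb{R}^n$ whose boundary $S$ consists of a finite number of smooth hypersurfaces. Let $A=A(x,\partial/\partial x)$ be a linear elliptic differential operator of (even) order $m$, and let $B_j=B_j(x,\partial/\partial x)$, $j=1,\dots,m/2$, be boundary differential operators such that: at every point $x$ of $S$ the normal direction is not characteristic for any $B_j$; and the order $m_j$ of $B_j$ is less than $m$, with $m_j\neq m_k$ for $j\ne k$. The domain of $A$ is $\mathcal{D}(A)=\{u\in H^m(U) : B_j(x,\partial/\partial x)u(x)=0 \text{ for } x\in S,\ j=1,\dots,m/2\}$. The ordered collection $(U,A,B_1,\dots,B_{m/2})$ is called admissable if $U$ is a bounded domain of $\mathbb{R}^n$ whose boundary $S$ consists of a finite number of smooth hypersurfaces, $A$ is a linear elliptic differential operator of (even) order $m$ with domain $\mathcal{D}(A)$, the $B_j$, $j=1,\dots,m/2$, are boundary differential operators of orders $m_j<m$, with $m_j\neq m_k$ for $j\neq k$, for none of which the normal direction is characteristic at any point of $S$, $A$ is a one-to-one mapping from $\mathcal{D}(A)$ onto $L^2(U)$, and $A^{-1}$ is self-adjoint in $L^2(U)$. The inverse $G=A^{-1}$ is called the Green's operator. It is a known standing fact that $G$ is represented by an integral operator of Hilbert–Schmidt type: $(Gf)(x)=\int_U G(x,\xi)f(\xi)\,d\xi$ for $f\in L^2(U)$, with $\int_U\int_U|G(x,\xi)|^2\,dx\,d\xi<\infty$;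 the kernel $G(x,\xi)$ is called the Green's function associated with the collection. It is also known that $G$ maps $L^2(U)$ continuously into $H^m(U)$, and hence, when $m>n/2$, continuously into $C^0(\bar U)$; in that case $Gf$ is identified with its continuous representative and the kernel is chosen so that $(Gf)(x)=\int_U G(x,\xi)f(\xi)\,d\xi$ holds for every $x\in U$ and every $f\in L^2(U)$. The mean value of $u$ over $U$ is $\frac{1}{|U|}\int_U u(x)\,dx$. *)

(* Defs.v *)
From HB Require Import structures.
From mathcomp Require Import all_boot all_order all_algebra.
From mathcomp Require Import all_classical all_reals all_analysis.

Set Implicit Arguments.
Unset Strict Implicit.
Unset Printing Implicit Defensive.

Import Order.TTheory GRing.Theory Num.Theory.
Import numFieldNormedType.Exports.

Local Open Scope classical_set_scope.
Local Open Scope ring_scope.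

(* Borel sigma-algebra of R^n, as generated by the coordinate functions. *)
Definition rV_display : measure_display. Proof. exact: default_measure_display. Qed.

Section measurable_rV.
Context (R : realType) (n : nat).

Let coord (i : 'I_n) (x : 'rV[R]_n) : R := x ord0 i.

Let rV_set0 : g_sigma_preimage coord set0.
Proof. exact: sigma_algebra0. Qed.

Let rV_setC A : g_sigma_preimage coord A -> g_sigma_preimage coord (~` A).
Proof. exact: sigma_algebraC. Qed.

Let rV_bigcup (F : (set 'rV[R]_n)^nat) :
  (forall i, g_sigma_preimage coord (F i)) ->
  g_sigma_preimage coord (\bigcup_i F i).
Proof. exact: sigma_algebra_bigcup. Qed.

HB.instance Definition _ := @isMeasurable.Build rV_display 'rV[R]_n
  (g_sigma_preimage coord) rV_set0 rV_setC rV_bigcup.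

Lemma measurable_rV_coord (i : 'I_n) :
  measurable_fun [set: 'rV[R]_n] (fun x : 'rV[R]_n => x ord0 i).
Proof.
move=> _ Y mY; rewrite setTI; apply: sub_sigma_algebra => /=.
rewrite -bigcup_seq/=; exists i => /=; first by rewrite mem_index_enum.
by exists Y => //; rewrite setTI.
Qed.

Lemma measurable_fun_rVP d (T : measurableType d) (f : T -> 'rV[R]_n) :
  (forall i, measurable_fun [set: T] (fun t => f t ord0 i)) ->
  measurable_fun [set: T] f.
Proof.
move=> mf _ Y mY; rewrite setTI.
have H : g_sigma_preimage coord `<=` [set B | measurable (f @^-1` B)].
  apply: smallest_sub.
    split => [|B /= mB|F /= mF].
    - by rewrite /= preimage_set0.
    - by rewrite setTD preimage_setC; exact: measurableC.
    - by rewrite preimage_bigcup; exact: bigcup_measurable.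
  move=> B; rewrite -bigcup_seq => -[i _ [C mC <-]] /=.
  by rewrite setTI -[X in measurable X]setTI; exact: mf.
exact: H.
Qed.

End measurable_rV.

Section lebesgue_step.
Local Open Scope ereal_scope.
Context (R : realType) (n : nat).
Variable mu : {sigma_finite_measure set 'rV[R]_n -> \bar R}.

Definition rV_cons (p : R * 'rV[R]_n) : 'rV[R]_n.+1 :=
  (row_mx (const_mx p.1 : 'rV_1) p.2 : 'rV_(1 + n)).

Definition rV_uncons (x : 'rV[R]_n.+1) : R * 'rV[R]_n :=
  (x ord0 ord0, \row_j x ord0 (lift ord0 j)).

Lemma rV_consK : cancel rV_cons rV_uncons.
Proof.
move=> [a x]; rewrite /rV_uncons /rV_cons /=; congr pair.
  by rewrite mxE; case: splitP => // j _; rewrite mxE.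
apply/rowP => j; rewrite !mxE; case: splitP => [k|k] /=.
  by rewrite /bump ord1.
by rewrite /bump !add1n => -[jk]; congr (x _ _); exact/val_inj.
Qed.

Lemma measurable_rV_cons : measurable_fun [set: (R * 'rV[R]_n)%type] rV_cons.
Proof.
apply: measurable_fun_rVP => i.
have [j|j] := splitP (i : 'I_(1 + n)) => ij.
  rewrite (_ : (fun _ => _) = fst); first exact: measurable_fst.
  apply/funext => -[a x] /=; rewrite mxE.
  by case: splitP => [k _|k]; [rewrite mxE|rewrite ij ord1].
rewrite (_ : (fun _ => _) = (fun x : 'rV[R]_n => x ord0 j) \o snd).
  by apply: measurableT_comp; [exact: measurable_rV_coord|exact: measurable_snd].
apply/funext => -[a x] /=; rewrite mxE.
case: splitP => [k|k]; first by rewrite ij ord1.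
by rewrite ij => /eqP; rewrite eqn_add2l => /eqP/val_inj ->.
Qed.

Lemma measurable_rV_uncons : measurable_fun [set: 'rV[R]_n.+1] rV_uncons.
Proof.
apply: measurable_fun_pair; first exact: measurable_rV_coord.
apply: measurable_fun_rVP => i.
rewrite (_ : (fun _ => _) = fun x : 'rV[R]_n.+1 => x ord0 (lift ord0 i)).
  exact: measurable_rV_coord.
by apply/funext => x; rewrite mxE.
Qed.

Definition lebesgue_step (A : set 'rV[R]_n.+1) : \bar R :=
  (lebesgue_measure \x mu) (rV_cons @^-1` A).

Let step0 : lebesgue_step set0 = 0.
Proof. by rewrite /lebesgue_step preimage_set0 measure0. Qed.

Let step_ge0 A : 0 <= lebesgue_step A.
Proof. exact: measure_ge0. Qed.

Let step_sigma_additive : semi_sigma_additive lebesgue_step.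
Proof.
move=> F mF tF mUF; rewrite /lebesgue_step preimage_bigcup.
apply: measure_semi_sigma_additive.
- by move=> k; rewrite -[X in measurable X]setTI; exact: measurable_rV_cons.
- apply/trivIsetP => /= i j _ _ ij; rewrite -preimage_setI.
  by move/trivIsetP : tF => /(_ _ _ _ _ ij) ->//; rewrite preimage_set0.
- by rewrite -preimage_bigcup -[X in measurable X]setTI; exact: measurable_rV_cons.
Qed.

HB.instance Definition _ := isMeasure.Build _ _ _ lebesgue_step
  step0 step_ge0 step_sigma_additive.

Let step_sigma_finite : sigma_finite setT lebesgue_step.
Proof.
have /sigma_finiteP[F [TF ndF Foo]] := @sigma_finiteT _ _ _
  [the {sigma_finite_measure set (measurableTypeR R) -> \bar R} of lebesgue_measure].
have /sigma_finiteP[H [TH ndH Hoo]] := sigma_finiteT mu.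
exists (fun k => rV_uncons @^-1` (F k `*` H k)).
  apply/esym; rewrite -subTset => x _.
  have : [set: measurableTypeR R] (rV_uncons x).1 by [].
  have : [set: 'rV[R]_n] (rV_uncons x).2 by [].
  rewrite TF TH => -[k _ Hk] [l _ Fl]; exists (maxn k l) => //; split.
    by move: Fl; exact/subsetPset/ndF/leq_maxr.
  by move: Hk; exact/subsetPset/ndH/leq_maxl.
move=> k; have [mF Fk] := Foo k; have [mH Hk] := Hoo k; split.
  by rewrite -[X in measurable X]setTI; apply: measurable_rV_uncons => //;
    exact: measurableX.
rewrite /lebesgue_step -comp_preimage (_ : _ \o _ = id) ?preimage_id.
  by rewrite product_measure1E// lte_mul_pinfty// ge0_fin_numE.
by apply/funext => p /=; rewrite rV_consK.
Qed.

HB.instance Definition _ := Measure_isSigmaFinite.Build _ _ _ lebesgue_step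
  step_sigma_finite.

End lebesgue_step.

(* n-dimensional Lebesgue measure: the n-fold product of the measure on R. *)
Fixpoint lebesgue_rV (R : realType) (n : nat) :
    {sigma_finite_measure set 'rV[R]_n -> \bar R} :=
  match n with
  | 0 => [the {sigma_finite_measure set 'rV[R]_0 -> \bar R} of
           \d_(0 : 'rV[R]_0)]
  | k.+1 => [the {sigma_finite_measure set 'rV[R]_k.+1 -> \bar R} of
             lebesgue_step (lebesgue_rV R k)]
  end.

Section hausdorff.
Local Open Scope ereal_scope.
Context (R : realType) (n s : nat).
Implicit Types (A : set 'rV[R]_n) (x : 'rV[R]_n).

Definition euclidean_norm x : R := Num.sqrt (\sum_i x ord0 i ^+ 2).

Definition diameter A : \bar R :=
  ereal_sup [set (euclidean_norm (p.1 - p.2)%R)%:E | p in A `*` A].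

Definition hausdorff_gauge (delta : R) A : \bar R :=
  if `[< A = set0 >] then 0
  else if diameter A <= delta%:E then diameter A ^+ s else +oo.

Lemma hausdorff_gauge0 delta : hausdorff_gauge delta set0 = 0.
Proof. by rewrite /hausdorff_gauge; case: asboolP. Qed.

Lemma hausdorff_gauge_ge0 delta A : 0 <= hausdorff_gauge delta A.
Proof.
rewrite /hausdorff_gauge; case: asboolP => // /eqP/set0P[x Ax].
case: ifPn => // _; apply: expe_ge0; apply: ereal_sup_ubound.
exists (x, x) => //=; rewrite subrr /euclidean_norm big1 ?sqrtr0// => i _.
by rewrite mxE expr0n.
Qed.

(* s-dimensional Hausdorff outer measure (without the normalizing constant),
   the covers being by Borel sets: passing to closures, this is the same as
   using arbitrary covers. *)
Definition hausdorff A : \bar R :=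
  ereal_sup [set (mu_ext (hausdorff_gauge delta) A) |
             delta in [set delta : R | (0 < delta)%R]].

Let mu_ext_le_hausdorff delta A :
  (0 < delta)%R -> mu_ext (hausdorff_gauge delta) A <= hausdorff A.
Proof. by move=> d0; apply: ereal_sup_ubound; exists delta. Qed.

Let hausdorff_ge0 A : 0 <= hausdorff A.
Proof.
apply: (le_trans _ (mu_ext_le_hausdorff A ltr01)).
by apply: mu_ext_ge0; exact: hausdorff_gauge_ge0.
Qed.

Let hausdorff0 : hausdorff set0 = 0.
Proof.
apply/eqP; rewrite eq_le hausdorff_ge0 andbT.
apply: ge_ereal_sup => _ [delta _ <-].
by rewrite mu_ext0//; [exact: hausdorff_gauge0|exact: hausdorff_gauge_ge0].
Qed.

Let le_hausdorff : {homo hausdorff : A B / A `<=` B >-> A <= B}.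
Proof.
move=> A B AB; apply: ge_ereal_sup => _ [delta d0 <-].
by apply: le_trans (mu_ext_le_hausdorff B d0); exact: le_mu_ext.
Qed.

Let hausdorff_sigma_subadditive : sigma_subadditive hausdorff.
Proof.
move=> F; apply: ge_ereal_sup => _ [delta d0 <-].
apply: le_trans (mu_ext_sigma_subadditive (@hausdorff_gauge_ge0 delta) F) _.
apply: lee_nneseries => [k _|k *]; last exact: mu_ext_le_hausdorff.
by move=> _; apply: mu_ext_ge0; exact: hausdorff_gauge_ge0.
Qed.

HB.instance Definition _ := isOuterMeasure.Build R 'rV[R]_n hausdorff
  hausdorff0 hausdorff_ge0 le_hausdorff hausdorff_sigma_subadditive.

End hausdorff.

Definition caratheodory_measure (R : realType) (T : pointedType)
    (mu : {outer_measure set T -> \bar R}) :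
    {measure set (caratheodory_type mu) -> \bar R} :=
  [the {measure set (caratheodory_type mu) -> \bar R} of
     (mu : set (caratheodory_type mu) -> \bar R)].

(* (n-1)-dimensional Hausdorff measure on R^n.  Only its null sets and the
   L^2-convergence are used below, so that the constant relating it to the
   surface measure is irrelevant. *)
Definition surface_measure (R : realType) (n : nat) :=
  caratheodory_measure
    [the {outer_measure set 'rV[R]_n -> \bar R} of @hausdorff R n n.-1].

Section L2.
Context d (T : measurableType d) (R : realType).
Variable mu : {measure set T -> \bar R}.
Implicit Types (D : set T) (f g : T -> R).

Definition L2 D f :=
  measurable_fun D f /\ (\int[mu]_(x in D) (f x ^+ 2)%:E < +oo)%E.

Definition L2_dot D f g : R := \int[mu]_(x in D) (f x * g x).

Definition cvg_L2 D (f : nat -> T -> R) g :=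
  (\int[mu]_(x in D) ((f k x - g x) ^+ 2)%:E)%E @[k --> \oo] --> 0%E.

End L2.

Section calculus.
Context (R : realType) (n : nat).
Implicit Types (f g u v w : 'rV[R]_n -> R) (U S : set 'rV[R]_n) (x : 'rV[R]_n).

Local Notation mu := (lebesgue_rV R n).
Local Notation sigma := (surface_measure R n).

Definition partial (i : 'I_n) f : 'rV[R]_n -> R :=
  fun x => 'D_(delta_mx ord0 i) f x.

Definition gradient f x : 'rV[R]_n := \row_i partial i f x.

(* C^oo functions on R^n; [s] lists the successive directions. *)
Definition smooth f := forall s : seq 'I_n,
  continuous (foldr partial f s) /\
  forall i x, derivable (foldr partial f s) x (delta_mx ord0 i).

(* The multi-indices of degree at most k are the [a : multi k] such that
   [mdeg a <= k]. *)
Definition multi k := {ffun 'I_n -> 'I_k.+1}.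

Definition mdeg k (a : multi k) : nat := \sum_i a i.

Definition mpartial k (a : multi k) f : 'rV[R]_n -> R :=
  foldr (fun i => iter (a i) (partial i)) f (enum 'I_n).

Definition test_function U f :=
  smooth f /\
  exists K, [/\ compact K, K `<=` U & forall x, ~ K x -> f x = 0].

Definition weak_derivative U k (a : multi k) u w :=
  forall f, test_function U f ->
    \int[mu]_(x in U) (u x * mpartial a f x) =
    (-1) ^+ mdeg a * \int[mu]_(x in U) (w x * f x).

Definition sobolev_derivative U k (a : multi k) u w :=
  L2 mu U w /\ weak_derivative U a u w.

Definition sobolev k U u :=
  L2 mu U u /\
  forall a : multi k, (mdeg a <= k)%N -> exists w, sobolev_derivative U a u w.

Definition cvg_sobolev k U (f : nat -> 'rV[R]_n -> R) u :=
  forall a : multi k, (mdeg a <= k)%N ->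
    exists2 w, sobolev_derivative U a u w &
      cvg_L2 mu U (fun j => mpartial a (f j)) w.

Definition boundary U := closure U `\` interior U.

(* [g] is the trace on the boundary of U of [u] in H^1(U). *)
Definition trace U u g :=
  L2 sigma (boundary U) g /\
  exists f : nat -> 'rV[R]_n -> R,
    [/\ forall j, smooth (f j), cvg_sobolev 1 U f u
      & cvg_L2 sigma (boundary U) f g].

(* Near x, S is the zero set of a smooth function which is regular at x. *)
Definition local_equation S x f :=
  [/\ smooth f, gradient f x != 0 &
      \forall y \near x, S y <-> f y = 0].

Definition smooth_hypersurface S :=
  closed S /\ forall x, S x -> exists f, local_equation S x f.

Definition normal S x (v : 'rV[R]_n) :=
  exists2 f, local_equation S x f & v = gradient f x.

(* The hypersurfaces are closed, disjoint and without boundary, so that the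
   boundary of U has neither edges nor corners. *)
Definition smooth_bounded_domain U :=
  [/\ open U, connected U, U !=set0, bounded_set U &
    exists (k : nat) (S : 'I_k -> set 'rV[R]_n),
      [/\ forall i, smooth_hypersurface (S i),
          trivIset setT S & boundary U = \bigcup_i S i]].

(* sum over [mdeg a <= order] of [coef a x] times the derivative of index a *)
Record diffop := Diffop {
  order : nat;
  coef : multi order -> 'rV[R]_n -> R }.

Implicit Types (A P : diffop).

Definition principal_symbol P x (xi : 'rV[R]_n) : R :=
  \sum_(a : multi (order P) | mdeg a == order P)
    coef a x * \prod_i xi ord0 i ^+ a i.

Definition apply_coef P x (z : multi (order P) -> 'rV[R]_n -> R) : R :=
  \sum_(a : multi (order P) | (mdeg a <= order P)%N) coef a x * z a x.

Definition continuous_coef S P :=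
  forall a : multi (order P), (mdeg a <= order P)%N ->
    {within S, continuous (coef a)}.

Definition elliptic U A :=
  forall x xi, U x -> xi != 0 -> principal_symbol A x xi != 0.

(* P u = f in U *)
Definition solves U P u f :=
  exists2 w : multi (order P) -> 'rV[R]_n -> R,
    forall a, (mdeg a <= order P)%N -> sobolev_derivative U a u (w a) &
    ae_eq mu U (fun x => apply_coef x w) f.

(* P u = 0 on the boundary of U, in the sense of traces *)
Definition vanishes_on_boundary U P u :=
  exists w g : multi (order P) -> 'rV[R]_n -> R,
    (forall a, (mdeg a <= order P)%N ->
       sobolev_derivative U a u (w a) /\ trace U (w a) (g a)) /\
    ae_eq sigma (boundary U) (fun x => apply_coef x g) (cst 0).

Section collection.
Variables (m : nat) (U : set 'rV[R]_n) (A : diffop) (B : 'I_m./2 -> diffop).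

Definition domain u :=
  sobolev m U u /\ forall j, vanishes_on_boundary U (B j) u.

(* G f = u, where G is the inverse of A on its domain; functions which are
   equal almost everywhere are not distinguished. *)
Definition green_operator f u := L2 mu U f /\ domain u /\ solves U A u f.

(* G coincides with its adjoint, as (the graph of) a possibly partial operator:
   (g, h) is in the graph of the adjoint iff <G f, g> = <f, h> for all f. *)
Definition self_adjoint_green :=
  forall g h, L2 mu U g -> L2 mu U h ->
    (forall f u, green_operator f u -> L2_dot mu U u g = L2_dot mu U f h) <->
    green_operator g h.

Record admissible : Prop := Admissible {
  adm_domain : smooth_bounded_domain U;
  adm_even : ~~ odd m;
  adm_orderA : order A = m;
  adm_coefA : continuous_coef (closure U) A;
  adm_elliptic : elliptic (closure U) A;
  adm_orderB : forall j, (order (B j) < m)%N;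
  adm_orderB_inj : injective (fun j => order (B j));
  adm_coefB : forall j, continuous_coef (boundary U) (B j);
  adm_noncharacteristic : forall j x (v : 'rV[R]_n),
    boundary U x -> normal (boundary U) x v -> principal_symbol (B j) x v != 0;
  adm_into : forall u, domain u -> exists2 f, L2 mu U f & solves U A u f;
  adm_injective : forall u v f,
    domain u -> domain v -> solves U A u f -> solves U A v f -> ae_eq mu U u v;
  adm_surjective : forall f, L2 mu U f ->
    exists2 u, domain u & solves U A u f;
  adm_self_adjoint : self_adjoint_green }.

(* v is the representative of u which is continuous on the closure of U *)
Definition continuous_representative u v :=
  {within closure U, continuous v} /\ ae_eq mu U u v.

(* The kernel of the Green's operator when m > n / 2: in this case G f has a
   continuous representative, which G represents at every point of U. *)
Record green_function (G : 'rV[R]_n -> 'rV[R]_n -> R) : Prop := GreenFunction {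
  green_measurable :
    measurable_fun (U `*` U) (fun z : 'rV[R]_n * 'rV[R]_n => G z.1 z.2);
  green_hilbert_schmidt :
    (\int[mu \x mu]_(z in U `*` U) ((G z.1 z.2) ^+ 2)%:E < +oo)%E;
  green_integrable : forall x f, U x -> L2 mu U f ->
    mu.-integrable U (fun y => (G x y * f y)%:E);
  green_kernel : forall f u, green_operator f u ->
    exists2 v, continuous_representative u v &
      forall x, U x -> v x = \int[mu]_(y in U) (G x y * f y) }.

Definition mean_value u : R :=
  (fine (mu U))^-1 * \int[mu]_(x in U) u x.

End collection.

End calculus.

(* Main.v *)
(* Let w be the continuous representative of G 1, so that w x is the integral of
   G(x, y) in y.  By self-adjointness the integral of G f over U is
   <G f, 1> = <f, G 1> = <f, w>.  Hence the mean value of G f is non-negative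
   as soon as w and f are; conversely, if w x < 0 for some x in U, then taking
   for f the indicator of a small ball around x makes <f, w> negative. *)

Require Import Defs.
From mathcomp Require Import all_boot all_order all_algebra.
From mathcomp Require Import all_classical all_reals all_analysis.
From mathcomp Require Import lra measurable_realfun.

Set Implicit Arguments.
Unset Strict Implicit.
Unset Printing Implicit Defensive.

Import Order.TTheory GRing.Theory Num.Theory.
Import numFieldNormedType.Exports.

Local Open Scope classical_set_scope.
Local Open Scope ring_scope.

(** * Borel sets and volumes of cubes in R^n *)

Section measure_rV.
Context (R : realType).

(** The ball of matrices contains [0 < e] as a conjunct, whereas for [n = 0] the right-hand side is
    the whole space whatever [e] is. *)
Lemma ball_rVE n (x : 'rV[R]_n) (e : R) : 0 < e ->
  ball x e = [set y | forall i, ball (x ord0 i) e (y ord0 i)].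
Proof.
move=> e0; apply/seteqP; split => [y [_ xy] i|y xy]; first exact: xy.
by split => // i j; rewrite ord1; exact: xy.
Qed.

Lemma measurable_ball_rV n (x : 'rV[R]_n) (e : R) : measurable (ball x e).
Proof.
have [e0|e0] := ltP 0 e; last first.
  rewrite (_ : ball x e = set0)//; apply/seteqP; split => // y [+ _].
  by rewrite ltNge e0.
have -> : ball x e = \big[setI/setT]_(i < n)
    ((fun y : 'rV[R]_n => y ord0 i) @^-1` ball (x ord0 i) e).
  rewrite ball_rVE// -bigcap_seq; apply/seteqP; split => [y xy i _|y xy i].
    exact: xy.
  by apply: xy => /=; rewrite mem_index_enum.
apply: bigsetI_measurable => i _.
rewrite -[X in measurable X]setTI; apply: measurable_rV_coord => //.
by rewrite ball_itv; exact: measurable_itv.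
Qed.

(** The sigma-algebra is generated by the coordinates, not by the open sets. But an open set is the
    union of the balls with rational centre and radius 1/(k+1) that it contains, and there are
    countably many of these. *)
Lemma open_measurable_rV n (V : set 'rV[R]_n) : open V -> measurable V.
Proof.
move=> oV.
pose q (p : 'rV[rat]_n) : 'rV[R]_n := map_mx ratr p.
pose F (p : 'rV[rat]_n * nat) : set 'rV[R]_n :=
  if `[< ball (q p.1) p.2.+1%:R^-1 `<=` V >] then ball (q p.1) p.2.+1%:R^-1
  else set0.
suff -> : V = \bigcup_p F p.
  apply: countable_bigcupT_measurable; first exact: countableP.
  by move=> p; rewrite /F; case: ifP => // _; exact: measurable_ball_rV.
apply/seteqP; split => [x Vx|x [p _]]; last first.
  by rewrite /F; case: asboolP => // + px; exact.
have [e /= e0 xeV] := (nbhs_ballP _ _).1 (open_nbhs_nbhs (conj oV Vx)).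
(* With a radius below [e / 2], a rational ball containing [x] has all its points at distance less
   than [e] from [x], hence lies in [V]. *)
have [k ke] : exists k, k.+1%:R^-1 < e / 2.
  have [k _] := near_infty_natSinv_lt (PosNum (divr_gt0 e0 (ltr0n R 2))).
  by move/(_ k (leqnn k)); exists k.
have k0 : 0 < k.+1%:R^-1 :> R by rewrite invr_gt0.
have rd i : {r : rat | ball (x ord0 i) k.+1%:R^-1 (ratr r)}.
  apply: cid.
  have [|r] := @rat_in_itvoo R (x ord0 i - k.+1%:R^-1) (x ord0 i + k.+1%:R^-1).
    by rewrite ltrBlDr -addrA ltrDl addr_gt0.
  by move=> rk; exists r; rewrite ball_itv.
have qx : ball (q (\row_i sval (rd i))) k.+1%:R^-1 x.
  apply: ball_sym; rewrite ball_rVE// => i; rewrite !mxE; exact: (svalP (rd i)).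
exists (\row_i sval (rd i), k) => //; rewrite /F /=.
case: asboolP => // -[y qy]; apply: xeV.
rewrite [e]splitr; apply: (ball_triangle (y := q (\row_i sval (rd i)))).
  by apply: ball_sym; exact: le_ball (ltW ke) _ qx.
exact: le_ball (ltW ke) _ qy.
Qed.

Lemma rV_cons_head n (p : R * 'rV[R]_n) : rV_cons p ord0 ord0 = p.1.
Proof. by have := congr1 (fun q => q.1) (rV_consK p). Qed.

Lemma rV_cons_behead n (p : R * 'rV[R]_n) j :
  rV_cons p ord0 (lift ord0 j) = p.2 ord0 j.
Proof.
by have := congr1 (fun q : R * 'rV[R]_n => q.2 ord0 j) (rV_consK p); rewrite mxE.
Qed.

(** Balls for the sup norm are cubes of side 2e, so the volume is computed by splitting off one
    coordinate at a time. In dimension 0 the Dirac mass gives 1. *)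
Lemma lebesgue_rV_ball n (x : 'rV[R]_n) (e : R) : 0 < e ->
  lebesgue_rV R n (ball x e) = ((e *+ 2) ^+ n)%:E.
Proof.
move=> e0; elim: n x => [|n IHn] x.
  rewrite expr0 /= diracE mem_set// ball_rVE// => -[].
  by case.
rewrite [LHS](_ : _ = (lebesgue_measure \x lebesgue_rV R n)%E
  (ball (x ord0 ord0) e `*` ball (\row_j x ord0 (lift ord0 j)) e)).
  rewrite product_measure1E.
  - rewrite IHn exprS EFinM; congr (_ * _)%E.
    exact: (lebesgue_measure_ball (x ord0 ord0) (ltW e0)).
  - by rewrite ball_itv; exact: measurable_itv.
  - exact: measurable_ball_rV.
rewrite /= /lebesgue_step; congr (_ _).
apply/seteqP; split => -[a y]; rewrite /preimage /setX /= !ball_rVE//=.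
  move=> xy; split; first by have := xy ord0; rewrite rV_cons_head.
  by move=> j; rewrite mxE; have := xy (lift ord0 j); rewrite rV_cons_behead.
move=> [xa xy] i; case: (unliftP ord0 i) => [j|] ->; last by rewrite rV_cons_head.
by have := xy j; rewrite mxE rV_cons_behead.
Qed.

Lemma bounded_set_ball n (V : set 'rV[R]_n) :
  bounded_set V -> exists2 M : R, 0 < M & V `<=` ball 0 M.
Proof.
(* [VM] only applies to numbers strictly above [M], which costs one unit; the ball is open, which
   costs the other. *)
move=> [M [_ VM]]; exists (`|M| + 2) => [|x Vx]; first by rewrite ltr_wpDl.
have : `|x| <= `|M| + 1 by apply: VM => //; rewrite (le_lt_trans (ler_norm _))// ltrDl.
move=> xM; rewrite mx_norm_ball /ball_ /= sub0r normrN (le_lt_trans xM)//.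
by rewrite ltrD2l ltr1n.
Qed.

Lemma lebesgue_rV_bounded n (V : set 'rV[R]_n) :
  measurable V -> bounded_set V -> (lebesgue_rV R n V < +oo)%E.
Proof.
move=> mV /bounded_set_ball[M M0 VM].
apply: (@le_lt_trans _ _ (lebesgue_rV R n (ball 0 M))).
  by apply: le_measure => //; rewrite inE//; exact: measurable_ball_rV.
by rewrite lebesgue_rV_ball// ltry.
Qed.

End measure_rV.

(** * Square-integrable functions and signs of integrals *)

Section L2_theory.
Context d (T : measurableType d) (R : realType).
Variables (mu : {measure set T -> \bar R}) (D : set T).
Hypothesis mD : measurable D.
Implicit Types f g : T -> R.

Lemma L2_le1 f : (mu D < +oo)%E -> measurable_fun D f ->
  (forall x, D x -> `|f x| <= 1) -> L2 mu D f.
Proof.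
move=> Dfin mf f1; split => //.
apply: (@le_lt_trans _ _ (\int[mu]_(x in D) (cst 1 x))%E); last first.
  by rewrite integral_cst// mul1e.
apply: ge0_le_integral => //.
- by move=> x _; rewrite lee_fin sqr_ge0.
- by apply/measurable_EFinP; exact: measurable_funX.
- by move=> x Dx; rewrite lee_fin -real_normK ?num_real// expr_le1// f1.
Qed.

(** The product is dominated by the integrable function f^2 + g^2. *)
Lemma L2_integrableM f g : L2 mu D f -> L2 mu D g ->
  mu.-integrable D (EFin \o (f \* g)).
Proof.
move=> [mf f2] [mg g2].
have sqr (h : T -> R) : measurable_fun D h -> (\int[mu]_(x in D) (h x ^+ 2)%:E < +oo)%E ->
    mu.-integrable D (fun x => (h x ^+ 2)%:E).
  move=> mh h2; apply/integrableP; split.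
    by apply/measurable_EFinP; exact: measurable_funX.
  by under eq_integral do rewrite gee0_abs ?lee_fin ?sqr_ge0//.
apply: (le_integrable mD _ _ (integrableD mD (sqr _ mf f2) (sqr _ mg g2))).
  by apply/measurable_EFinP; exact: measurable_funM.
move=> x Dx /=; rewrite lee_fin normrM.
rewrite [leRHS]ger0_norm ?addr_ge0 ?sqr_ge0//.
rewrite -[f x ^+ 2]real_normK ?num_real// -[g x ^+ 2]real_normK ?num_real//.
have AMGM (a b : R) : 0 <= a -> 0 <= b -> a * b <= a ^+ 2 + b ^+ 2 by nra.
exact: AMGM.
Qed.

(** Such an [f] agrees almost everywhere with its absolute value. *)
Lemma ae_Rintegral_ge0 f : measurable_fun D f ->
  {ae mu, forall x, D x -> 0 <= f x} -> 0 <= \int[mu]_(x in D) f x.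
Proof.
move=> mf f0; rewrite /Rintegral (ae_eq_integral (fun x => `|f x|%:E)) //.
- exact: Rintegral_ge0.
- exact/measurable_EFinP.
- by apply/measurable_EFinP; exact: measurableT_comp.
- by apply: filterS f0 => x f0 Dx; rewrite ger0_norm// f0.
Qed.

End L2_theory.

Theorem theorem3p3 (R : realType) (m n : nat) (U : set 'rV[R]_n)
    (A : diffop R n) (B : 'I_m./2 -> diffop R n)
    (G : 'rV[R]_n -> 'rV[R]_n -> R) :
  (0 < m)%N -> (0 < n)%N -> n%:R / 2 < m%:R :> R ->
  admissible U A B -> green_function U A B G ->
  [<-> (forall u v : 'rV[R]_n -> R,
          domain U B u -> solves U A u (cst 1) ->
          continuous_representative U u v ->
          forall x, U x -> 0 <= v x);
       (forall x, U x -> 0 <= \int[lebesgue_rV R n]_(y in U) G x y);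
       (forall f u : 'rV[R]_n -> R,
          L2 (lebesgue_rV R n) U f ->
          {ae lebesgue_rV R n, forall x, U x -> 0 <= f x} ->
          domain U B u -> solves U A u f ->
          0 <= mean_value U u)].
Proof.
move=> _ _ _ adm gG; set mu := lebesgue_rV R n.
have [oU _ [x0 Ux0] bU _] := adm_domain adm.
have mU : measurable U := open_measurable_rV oU.
have Ufin : (mu U < +oo)%E := lebesgue_rV_bounded mU bU.
have U_gt0 : 0 < fine (mu U).
  have [e /= e0 xeU] := (nbhs_ballP _ _).1 (open_nbhs_nbhs (conj oU Ux0)).
  rewrite fine_gt0// Ufin andbT.
  apply: (@lt_le_trans _ _ (mu (ball x0 e))).
    by rewrite lebesgue_rV_ball// lte_fin exprn_gt0// mulrn_wgt0.
  by apply: le_measure => //; rewrite inE//; exact: measurable_ball_rV.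
have L1 : L2 mu U (cst 1) by apply: L2_le1 => // x _; rewrite normr1.
have integral_green f u g : green_operator U A B f u ->
    green_operator U A B (cst 1) g ->
    \int[mu]_(x in U) u x = L2_dot mu U f g.
  move=> Gf G1; have Lg : L2 mu U g := G1.2.1.1.1.
  (* The pair (1, g) is in the graph of the Green's operator, hence in that of its adjoint. *)
  rewrite -((adm_self_adjoint adm L1 Lg).2 G1 f u Gf).
  by apply: eq_Rintegral => x _; rewrite mulr1.
have [u1 du1 su1] := adm_surjective adm L1.
have G1 : green_operator U A B (cst 1) u1 by [].
have [v1 u1v1 v1E] := green_kernel gG G1.
have v1G x : U x -> v1 x = \int[mu]_(y in U) G x y.
  by move=> Ux; rewrite v1E//; apply: eq_Rintegral => y _; rewrite mulr1.
(* The cycle is (i) to (ii) to (iii) to (i). The first two steps use the fixed solution [u1]; the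
   last one treats an arbitrary solution [u] with its representative [v]. *)
tfae => [solution_ge0 x Ux|G_ge0 f u Lf f_ge0 du su|mean_ge0 u v du su [cv uv] x Ux].
- by rewrite -v1G//; exact: solution_ge0 u1v1 _ Ux.
- apply: mulr_ge0; first by rewrite invr_ge0 ltW.
  rewrite (integral_green f u u1)//; apply: ae_Rintegral_ge0 => //.
    by apply: measurable_funM; [exact: Lf.1|exact: du1.1.1.1].
  apply: filterS2 f_ge0 u1v1.2 => y fy_ge0 u1v1y Uy.
  by rewrite mulr_ge0 ?fy_ge0// u1v1y// v1G// G_ge0.
- rewrite leNgt; apply/negP => vx0.
  (* Continuity within the closure of [U] restricts to the open set [U], where it is ordinary
     continuity. *)
  have cvx : {for x, continuous v}.
    move: cv => /(continuous_subspaceW (@subset_closure _ U)).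
    by rewrite continuous_open_subspace// => /(_ x (mem_set Ux)).
  (* As [v x] is negative, [v x / 2] lies strictly between [v x] and 0: it bounds [v] away from 0
     near [x]. *)
  have vx : \forall y \near x, v y < v x / 2.
    have : \forall z \near v x, z < v x / 2 by apply: lt_nbhsl; lra.
    exact: cvx.
  have [e /= e0 xe] := (nbhs_ballP _ _).1
    (filterI (open_nbhs_nbhs (conj oU Ux)) vx).
  have mB := measurable_ball_rV x e.
  pose f : 'rV[R]_n -> R := \1_(ball x e).
  have mf : measurable_fun U f by exact: measurable_indic.
  have Lf : L2 mu U f.
    apply: L2_le1 => // y _.
    by rewrite /f indicE; case: (_ \in _); rewrite ?normr1 ?normr0.
  have [w dw sw] := adm_surjective adm Lf.
  have Lu : L2 mu U u := du.1.1.
  have : 0 <= L2_dot mu U f u.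
    rewrite -(integral_green f w u)//.
    (* Multiplying by the inverse of the volume of [U] turns the integral of [w] into its mean
       value. *)
    rewrite -(pmulr_rge0 _ (x := (fine (mu U))^-1)) ?invr_gt0//.
    by apply: mean_ge0 dw sw => //; apply: aeW => y _; rewrite /f indicE.
  apply/negP; rewrite -ltNge.
  have fu_int := L2_integrableM mU Lf Lu.
  have f_int : mu.-integrable U (EFin \o f).
    have := L2_integrableM mU Lf L1; congr (_.-integrable _ _).
    by apply/funext => y; rewrite /= mulr1.
  have int_f : \int[mu]_(y in U) f y = (e *+ 2) ^+ n.
    rewrite /Rintegral integral_indic// setIidl => [|y /xe[]//].
    exact: (congr1 fine (lebesgue_rV_ball x e0)).
  (* Almost everywhere on [U], f u is at most (v x / 2) f: both vanish off the ball, and on it u = v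
     < v x / 2. Hence the integral of f u is at most (v x / 2) (2e)^n, which is negative. *)
  have : 0 <= \int[mu]_(y in U) (v x / 2 * f y - f y * u y).
    apply: ae_Rintegral_ge0 => //.
      apply: measurable_funB; last by apply: measurable_funM => //; exact: Lu.1.
      exact: measurable_funM.
    apply: filterS uv => y uvy Uy; rewrite /f indicE.
    have [yB|yB] := pselect (ball x e y); last first.
      by rewrite memNset// mulr0 mul0r subrr.
    by rewrite mem_set// mulr1 mul1r uvy// subr_ge0 ltW//; have [] := xe _ yB.
  rewrite RintegralB//; last exact: (integrableZl mU _ f_int).
  rewrite RintegralZl// int_f subr_ge0 => /le_lt_trans; apply.
  by rewrite nmulr_rlt0 ?exprn_gt0 ?mulrn_wgt0//; lra.
Qed.
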